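(* Let $0\le L<1$ and $\sigma^2\in(0,1]$. Let $p_X\colon\mathbb{R}\to\mathbb{R}_{\ge 0}$ be a probability density function with existing first and second moments and expectation $\mu_X=\int_{\mathbb{R}}p_X(x)\,x\,\mathrm{d}x$. Let $\mathcal{F}=\{f\in C^{0,1}(\mathbb{R})\,|\,\mathrm{Lip}(f)\le L\}$ be the set of Lipschitz continuous functions $\mathbb{R}\to\mathbb{R}$ with Lipschitz constant at most $L$. Then $$f^*(x)=\begin{cases}(1-\sigma^2)\,x & \text{if } 1-\sigma^2\le L,\\ Lx+(1-\sigma^2-L)\,\mu_X & \text{if } 1-\sigma^2>L\end{cases}$$ is a solution of the minimization problem $$\min_{f\in\mathcal{F}}\int_{\mathbb{R}}p_X(x)\,|(1-\sigma^2)x-f(x)|^2\,\mathrm{d}x .$$ This solution is unique on $\mathrm{supp}(p_X)$, i.e. every minimizer coincides with $f^*$ on $\mathrm{supp}(p_X)$; and if $1-\sigma^2>L$, it is even unique on the convex hull of $\mathrm{supp}(p_X)$, i.e. every minimizer coincides with $f^*$ on that convex hull.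
   Context: A probability density function (pdf) on $\mathbb{R}$ is a nonnegative measurable function with Lebesgue integral $1$. Existing first and second moments means that $p_X(x)|x|$ and $p_X(x)|x|^2$ are Lebesgue-integrable. $\mathrm{Lip}(f)$ denotes the (smallest) Lipschitz constant of $f$. $\mathrm{supp}(p_X)$ denotes the support of the probability measure $p_X(x)\,\mathrm{d}x$, i.e. the set of points all of whose open neighbourhoods have positive $p_X\,\mathrm{d}x$-measure. *)

(* Defs.v *)
From HB Require Import structures.
From mathcomp Require Import all_boot all_order all_algebra.
From mathcomp Require Import all_classical all_reals all_analysis.

Set Implicit Arguments.
Unset Strict Implicit.
Unset Printing Implicit Defensive.

Import Order.TTheory GRing.Theory Num.Theory.
Import numFieldNormedType.Exports.

Local Open Scope classical_set_scope.
Local Open Scope ring_scope.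

Definition is_pdf (R : realType) (p : R -> R) : Prop :=
  [/\ measurable_fun [set: R] p,
      forall x, 0 <= p x &
      (\int[@lebesgue_measure R]_x (p x)%:E = 1)%E].

Definition has_first_second_moments (R : realType) (p : R -> R) : Prop :=
  (@lebesgue_measure R).-integrable [set: R] (fun x => (p x * `|x|)%:E) /\
  (@lebesgue_measure R).-integrable [set: R] (fun x => (p x * `|x| ^+ 2)%:E).

Definition pdf_mean (R : realType) (p : R -> R) : R :=
  \int[@lebesgue_measure R]_x (p x * x).

Definition pdf_measure (R : realType) (p : R -> R) (A : set R) : \bar R :=
  (\int[@lebesgue_measure R]_(x in A) (p x)%:E)%E.

Definition pdf_support (R : realType) (p : R -> R) : set R :=
  [set x | forall U : set R, open U -> U x -> (0 < pdf_measure p U)%E].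

(* The set is bounded below by 0; it is empty, and the infimum is then the junk
   value 0, exactly when f is not Lipschitz: hence the first conjunct in
   lip_class. *)
Definition Lip (R : realType) (f : R -> R) : R :=
  inf [set k : R | k.-lipschitz f].

Definition lip_class (R : realType) (L : R) : set (R -> R) :=
  [set f | lipschitz f /\ Lip f <= L].

(* Instantiated at M := R^o for subsets of the real line. *)
Definition convex_hull (R : numDomainType) (M : lmodType R) (A : set M) :
    set M :=
  smallest (@convex_set R M) A.

Definition objective (R : realType) (p : R -> R) (sigma : R) (f : R -> R) :
    \bar R :=
  (\int[@lebesgue_measure R]_x
     (p x * `|(1 - sigma ^+ 2) * x - f x| ^+ 2)%:E)%E.

Definition is_minimizer (R : realType) (T : Type) (F : set T)
    (J : T -> \bar R) (f : T) : Prop :=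
  F f /\ forall g, F g -> (J f <= J g)%E.

Definition fstar (R : realType) (L sigma muX : R) (x : R) : R :=
  if 1 - sigma ^+ 2 <= L then (1 - sigma ^+ 2) * x
  else L * x + (1 - sigma ^+ 2 - L) * muX.

(* Main.v *)
Require Import Defs.
From mathcomp Require Import all_boot all_order all_algebra.
From mathcomp Require Import all_classical all_reals all_analysis.
From mathcomp Require Import measurable_realfun ring lra.
Import Order.TTheory GRing.Theory Num.Theory.
Import numFieldNormedType.Exports.
Local Open Scope classical_set_scope.
Local Open Scope ring_scope.

(** Write [a = 1 - sigma ^+ 2], let [m] be the mean of [p], and for a competitor
    [f] put [s x = fstar x - f x], so that the residual [a * x - f x] of [f] is
    the residual of [fstar] plus [s x]. Everything follows from the inequality
    [J fstar + \int p * s ^+ 2 <= J f] for the objective [J]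
    ([objective_fstar_add_le]).

    If [a <= L], the residual of [fstar] is zero and the inequality is an
    equality. If [L < a], the residual of [fstar] is [(a - L) * (x - m)], and
    expanding the square leaves the cross term
    [2 * (a - L) * \int p * (x - m) * s x]. It is nonnegative: [p] being
    centred at [m], one may replace [s x] by [s x - s m], and since [fstar] has
    slope [L] while [f] is [L]-Lipschitz, [s] is nondecreasing
    ([fstar_sub_homo]), so that [(x - m) * (s x - s m)] is nonnegative
    pointwise.

    Minimality of [fstar] is then immediate. Since [J fstar] is finite, a
    minimizer [f] satisfies [\int p * s ^+ 2 = 0], and [s], being continuous,
    vanishes on the support ([support_eq0]). In the case [L < a], the zero set
    of the nondecreasing function [s] is convex ([convex_set_homo_eq0]), hence
    contains the convex hull of the support. *)

(** * Lipschitz functions on the real line *)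

Lemma klipschitz_realP (R : realType) (k : R) (f : R -> R) :
  k.-lipschitz f <-> forall x y, `|f x - f y| <= k * `|x - y|.
Proof.
split=> [H x y|H [x y] _ /=]; last exact: H.
by have /= := H (x, y); apply; split.
Qed.

(** The infimum defining [Lip] is attained, so membership in the class is the
    plain Lipschitz inequality with constant [L]. *)
Lemma lip_classP (R : realType) (L : R) (f : R -> R) :
  lip_class L f <-> forall x y, `|f x - f y| <= L * `|x - y|.
Proof.
have PF := @globally_properfilter _ ([set: R] `*` [set: R]) (0, 0) (conj I I).
have lb0 : has_lbound [set k : R | k.-lipschitz f].
  exists 0 => k /= /klipschitz_realP /(_ 1 0).
  rewrite subr0 normr1 mulr1; exact: le_trans.
split=> [|H].
  move=> [lipf LipL] x y.
  have [k klip] : exists k, k.-lipschitz f by exact/ex_dom_bound.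
  have [->|xy] := eqVneq x y; first by rewrite !subrr normr0 mulr0.
  have xy0 : 0 < `|x - y| by rewrite normr_gt0 subr_eq0.
  rewrite -ler_pdivrMr//; apply: le_trans LipL.
  apply: lb_le_inf; first by exists k.
  by move=> l /= /klipschitz_realP lip; rewrite ler_pdivrMr.
have /klipschitz_realP lip := H.
split; first exact: klipschitzW lip.
exact: ge_inf.
Qed.

Lemma lip_class_continuous (R : realType) (L : R) (f : R -> R) :
  lip_class L f -> continuous f.
Proof.
move=> /lip_classP lip x; apply/cvgrPdist_le => e e0.
have L1 : 0 < `|L| + 1 by rewrite ltr_wpDl.
near=> y.
apply: le_trans (lip _ _) _.
apply: (@le_trans _ _ ((`|L| + 1) * `|x - y|)).
  by rewrite ler_wpM2r// (le_trans (ler_norm L))// lerDl.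
rewrite mulrC -ler_pdivlMr//.
near: y; apply: (@cvgr_dist_le _ _ _ _ _ id); first exact: cvg_id.
exact: divr_gt0.
Unshelve. all: by end_near. Qed.

Lemma lip_class_affine (R : realType) (L a b : R) :
  `|a| <= L -> lip_class L (fun x => a * x + b).
Proof.
move=> aL; apply/lip_classP => x y.
have -> : a * x + b - (a * y + b) = a * (x - y) by ring.
by rewrite normrM ler_wpM2r.
Qed.

(** * The affine candidate *)

Lemma fstar_le (R : realType) (L sigma m x : R) :
  1 - sigma ^+ 2 <= L -> fstar L sigma m x = (1 - sigma ^+ 2) * x.
Proof. by rewrite /fstar => ->. Qed.

Lemma fstar_gt (R : realType) (L sigma m x : R) :
  L < 1 - sigma ^+ 2 ->
  fstar L sigma m x = L * x + (1 - sigma ^+ 2 - L) * m.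
Proof. by move=> La; rewrite /fstar leNgt La. Qed.

Lemma fstar_affine (R : realType) (L sigma m : R) : exists b,
  fstar L sigma m = fun x => Num.min (1 - sigma ^+ 2) L * x + b.
Proof.
case: (leP (1 - sigma ^+ 2) L) => aL.
  by exists 0; apply/funext => x; rewrite fstar_le// addr0.
by exists ((1 - sigma ^+ 2 - L) * m); apply/funext => x; rewrite fstar_gt.
Qed.

Lemma fstar_lip_class (R : realType) (L sigma m : R) :
  0 <= L -> sigma ^+ 2 <= 1 -> lip_class L (fstar L sigma m).
Proof.
move=> L0 s1; have [b ->] := fstar_affine R L sigma m.
apply: lip_class_affine; rewrite ger0_norm ?ge_min ?lexx ?orbT//.
by rewrite le_min subr_ge0 s1.
Qed.

(** When the slope constraint is active, [fstar] has the largest slope that the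
    class allows, so its difference with any competitor is monotone. This is
    how the Lipschitz bound enters both the optimality of [fstar] and the passage
    of equality from the support to its convex hull. *)
Lemma fstar_sub_homo (R : realType) (L sigma m : R) (f : R -> R) :
  L < 1 - sigma ^+ 2 -> lip_class L f ->
  {homo (fun x => fstar L sigma m x - f x) : x y / x <= y}.
Proof.
move=> La /lip_classP lip x y xy; rewrite !fstar_gt//.
have := le_trans (ler_norm _) (lip y x).
rewrite [X in L * X]ger0_norm ?subr_ge0//; lra.
Qed.

(** * Integrals and supports *)

(** When the integral of [a] is infinite there is nothing to prove; otherwise
    [a] is integrable, so that [w], whose sign may vary, can be subtracted from
    it. *)
Lemma integral_add_le d (T : measurableType d) (R : realType)
    (mu : {measure set T -> \bar R}) (a b w : T -> R) :
  measurable_fun setT a -> measurable_fun setT b ->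
  mu.-integrable setT (EFin \o w) ->
  (forall x, 0 <= b x) -> (forall x, 0 <= a x) ->
  (forall x, w x + b x <= a x) ->
  (\int[mu]_x (w x)%:E + \int[mu]_x (b x)%:E <= \int[mu]_x (a x)%:E)%E.
Proof.
move=> ma mb iw b0 a0 wba.
have [aoo|] := eqVneq (\int[mu]_x (a x)%:E)%E +oo%E; first by rewrite aoo leey.
rewrite -ltey => aoo.
have ia : mu.-integrable setT (EFin \o a).
  apply/integrableP; split; first exact/measurable_EFinP.
  by under eq_integral do rewrite /= ger0_norm//.
rewrite addeC -leeBrDr; last exact: integrable_fin_num.
rewrite -integralB//.
apply: ge0_le_integral => //.
- by move=> x _; rewrite lee_fin.
- exact/measurable_EFinP.
- apply/measurable_EFinP; apply: measurable_funB => //.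
  by case/integrableP: iw => /measurable_EFinP.
- by move=> x _; rewrite -EFinB lee_fin lerBrDl.
Qed.

(** The set where a continuous [g] does not vanish is open, and [p] is almost
    everywhere zero on it, so it cannot meet the support. *)
Lemma support_eq0 (R : realType) (p g : R -> R) :
  is_pdf p -> continuous g ->
  (\int[@lebesgue_measure R]_x (p x * g x ^+ 2)%:E = 0)%E ->
  forall x, pdf_support p x -> g x = 0.
Proof.
move=> [mp p0 _] cg int0 x suppx; apply/eqP/negP => /negP gx0.
pose U := g @^-1` [set z | z != 0].
have oU : open U by apply: open_comp => //; exact: open_neq.
have := suppx U oU gx0; rewrite /pdf_measure.
suff -> : (\int[@lebesgue_measure R]_(y in U) (p y)%:E = 0)%E by rewrite ltxx.
have mU : measurable U by exact: open_measurable.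
have mg : measurable_fun setT g by exact: continuous_measurable_fun.
have mpg : measurable_fun setT (fun y => (p y * g y ^+ 2)%:E).
  by apply/measurable_EFinP/measurable_funM => //; exact: measurable_funX.
have : ae_eq lebesgue_measure setT (fun y => (p y * g y ^+ 2)%:E) (cst 0%E).
  apply/ae_eq_integral_abs => //.
  rewrite -int0; apply: eq_integral => y _ /=.
  by rewrite ger0_norm// mulr_ge0// sqr_ge0.
move=> pg0.
rewrite (ae_eq_integral (cst 0%E))//; first by rewrite integral0.
  exact/measurable_EFinP/measurable_funTS.
apply: filterS pg0 => y /= /(_ I) [/eqP].
rewrite mulf_eq0 sqrf_eq0 => /orP[/eqP->//|/eqP gy0] Uy.
by move: Uy; rewrite /U /= gy0 eqxx.
Qed.

(** * The projection inequality *)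

(** [h] is the residual of a competitor, [g = (a - L) * (x - m)] the residual of
    [fstar], and [s = h - g] is monotone with value [s0] at [m]. The cross term
    [2 * g * s] is at least [2 * g * s0] because [s - s0] and [x - m] have the same
    sign. This lower bound is a multiple of [x - m], which vanishes in mean
    when [m] is the mean. *)
Lemma residual_sqr_ge (R : realDomainType) (a L m s0 g s h x : R) :
  L < a -> g = (a - L) * (x - m) -> h = g + s -> 0 <= (x - m) * (s - s0) ->
  g ^+ 2 + 2 * (a - L) * s0 * (x - m) + s ^+ 2 <= h ^+ 2.
Proof.
move=> La -> -> mono.
have : 0 <= (a - L) * ((x - m) * (s - s0)) by rewrite mulr_ge0// subr_ge0 ltW.
lra.
Qed.

Section density.
Context (R : realType) (p : R -> R).
Context (hp : is_pdf p) (hmom : has_first_second_moments p).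
Let mu := @lebesgue_measure R.

(** The integrands attached to [fstar] alone are all of this form, [fstar] being
    affine. *)
Lemma integrable_quadratic (a b c : R) :
  mu.-integrable setT (EFin \o (fun x => p x * (a * x ^+ 2 + b * x + c))).
Proof.
have [mp p0 ip] := hp; have [m1 m2] := hmom.
have i0 : mu.-integrable setT (EFin \o p).
  apply/integrableP; split; first exact/measurable_EFinP.
  under eq_integral do rewrite /= ger0_norm//.
  by rewrite ip ltey.
have i1 : mu.-integrable setT (EFin \o (fun x => p x * x)).
  apply: le_integrable m1 => //.
    by apply/measurable_EFinP/measurable_funM.
  by move=> x _ /=; rewrite lee_fin !normrM normr_id.
have i2 : mu.-integrable setT (EFin \o (fun x => p x * x ^+ 2)).
  by apply: eq_integrable m2 => // x _ /=; rewrite real_normK// num_real.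
have -> : EFin \o (fun x => p x * (a * x ^+ 2 + b * x + c)) =
    (((fun x => a%:E * (p x * x ^+ 2)%:E) \+ (fun x => b%:E * (p x * x)%:E)) \+
     (fun x => c%:E * (p x)%:E))%E.
  by apply/funext => x /=; rewrite -!EFinM -!EFinD; congr EFin; ring.
by apply: integrableD => //; [apply: integrableD => //|]; exact: integrableZl.
Qed.

Lemma integral_centered :
  (\int[mu]_x (p x * (x - pdf_mean p))%:E = 0)%E.
Proof.
have [mp p0 ip] := hp.
have i0 := integrable_quadratic 0 0 1.
have i1 := integrable_quadratic 0 1 0.
transitivity (\int[mu]_x ((p x * (0 * x ^+ 2 + 1 * x + 0))%:E -
   (pdf_mean p)%:E * (p x * (0 * x ^+ 2 + 0 * x + 1))%:E))%E.
  by apply: eq_integral => x _; rewrite -EFinM -EFinB; congr EFin; ring.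
rewrite integralB//; last exact: integrableZl.
rewrite integralZl//.
have -> : (\int[mu]_x (p x * (0 * x ^+ 2 + 0 * x + 1))%:E = 1)%E.
  by rewrite -ip; apply: eq_integral => x _; congr EFin; ring.
have eq1 : (\int[mu]_x (p x * (0 * x ^+ 2 + 1 * x + 0))%:E =
            (pdf_mean p)%:E)%E.
  rewrite -(fineK (integrable_fin_num _ i1))//; congr (_%:E); congr fine.
  by apply: eq_integral => x _; congr EFin; ring.
by rewrite eq1 mule1 subee.
Qed.

Lemma objective_fstar_fin_num (L sigma m : R) :
  objective p sigma (fstar L sigma m) \is a fin_num.
Proof.
have [b ->] := fstar_affine R L sigma m.
set l := Num.min _ _; set a := 1 - sigma ^+ 2.
have i := integrable_quadratic ((a - l) ^+ 2) (- (2 * (a - l) * b)) (b ^+ 2).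
have <- : (\int[mu]_x (p x * ((a - l) ^+ 2 * x ^+ 2 +
    - (2 * (a - l) * b) * x + b ^+ 2))%:E)%E =
    objective p sigma (fun x => l * x + b).
  apply: eq_integral => x _ /=; congr (_%:E); congr (_ * _).
  by rewrite real_normK ?num_real// -/a; ring.
exact: integrable_fin_num i.
Qed.

(** The excess of a competitor over [fstar] dominates its squared distance to
    [fstar] in the space of functions square integrable against [p]: this gives
    both minimality and uniqueness. It is the projection inequality onto the
    convex class, obtained when [L < 1 - sigma ^+ 2] by integrating
    [residual_sqr_ge]. *)
Lemma objective_fstar_add_le (L sigma : R) (f : R -> R) : lip_class L f ->
  (objective p sigma (fstar L sigma (pdf_mean p)) +
   \int[mu]_x (p x * (fstar L sigma (pdf_mean p) x - f x) ^+ 2)%:E <=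
   objective p sigma f)%E.
Proof.
move=> lipf; have [mp p0 _] := hp.
have mf : measurable_fun setT f.
  by apply: continuous_measurable_fun => x; exact: lip_class_continuous lipf x.
set m := pdf_mean p; set a := 1 - sigma ^+ 2.
have [aL|La] := leP a L.
  rewrite (_ : objective _ _ (fstar _ _ _) = 0%E) ?add0e; last first.
    rewrite -[RHS](@integral0 _ _ _ mu setT).
    apply: eq_integral => x _ /=.
    by rewrite fstar_le// subrr normr0 expr0n/= mulr0.
  rewrite le_eqVlt; apply/orP; left; apply/eqP.
  apply: eq_integral => x _ /=.
  by rewrite fstar_le// real_normK ?num_real.
have fE x : fstar L sigma m x = L * x + (a - L) * m by exact: fstar_gt.
pose g x := (a - L) * (x - m).
pose s x := fstar L sigma m x - f x.
have s_homo : {homo s : x y / x <= y} by exact: fstar_sub_homo.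
pose k := 2 * (a - L) * s m.
pose w x := p x * (g x ^+ 2 + k * (x - m)).
(* [w] integrates to the objective of [fstar], its linear part having mean 0. *)
have iw1 : mu.-integrable setT (EFin \o (fun x => p x * g x ^+ 2)).
  apply: eq_integrable (integrable_quadratic ((a - L) ^+ 2)
     (- (2 * (a - L) ^+ 2 * m)) ((a - L) ^+ 2 * m ^+ 2)) => // x _ /=.
  by congr (_%:E); rewrite /g; ring.
have iw2 : mu.-integrable setT (EFin \o (fun x => p x * (x - m))).
  apply: eq_integrable (integrable_quadratic 0 1 (- m)) => // x _ /=.
  by congr (_%:E); ring.
have wE : EFin \o w = (EFin \o (fun x => p x * g x ^+ 2)) \+
    (fun x => k%:E * (p x * (x - m))%:E)%E.
  by apply/funext => x /=; rewrite -EFinM -EFinD; congr EFin; rewrite /w; ring.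
have iw : mu.-integrable setT (EFin \o w).
  by rewrite wE; apply: integrableD => //; exact: integrableZl.
have -> : objective p sigma (fstar L sigma m) = (\int[mu]_x (w x)%:E)%E.
  rewrite -/((EFin \o w) _).
  under [RHS]eq_integral do rewrite -[(w _)%:E]/((EFin \o w) _) wE.
  rewrite integralD//; last exact: integrableZl.
  rewrite integralZl// integral_centered mule0 adde0.
  apply: eq_integral => x _; congr (_%:E); congr (_ * _).
  by rewrite real_normK ?num_real// fE /g -/a; ring.
have ms : measurable_fun setT s.
  apply: measurable_funB => //.
  have -> : fstar L sigma m = fun x => L * x + (a - L) * m by exact/funext.
  by apply: measurable_funD => //; exact: measurable_funM.
apply: integral_add_le => //.
- apply: measurable_funM => //; apply/measurable_funX/measurableT_comp => //.
  apply: measurable_funB; first exact: measurable_funM.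
  exact: mf.
- by apply: measurable_funM => //; exact: measurable_funX.
- by move=> x; rewrite mulr_ge0// sqr_ge0.
- by move=> x; rewrite mulr_ge0// exprn_ge0.
- move=> x; rewrite /w -mulrDr ler_wpM2l// real_normK ?num_real//.
  apply: (@residual_sqr_ge R a L m (s m)) => //.
    by rewrite /s fE /g -/a; ring.
  have [xm|/ltW mx] := leP x m.
    by rewrite mulr_le0// subr_le0//; exact: s_homo.
  by rewrite mulr_ge0// subr_ge0//; exact: s_homo.
Qed.

End density.

(** * Minimality and uniqueness *)

(** A monotone function that vanishes at two points is squeezed to zero between
    them. *)
Lemma convex_set_homo_eq0 (R : realType) (s : R -> R) :
  {homo s : x y / x <= y} -> convex_set ([set x | s x = 0] : set R^o).
Proof.
move=> hs.
have between x y z : s x = 0 -> s y = 0 -> z \in `[x, y] -> s z = 0.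
  move=> sx sy; rewrite in_itv/= => /andP[/hs + /hs]; rewrite sx sy => z0 z1.
  by apply/le_anti; rewrite z0 z1.
move=> x y k; rewrite !inE /= => sx sy.
have [xy|/ltW yx] := leP (x : R) y.
  exact: between sx sy (convR_itv k xy).
by rewrite convC; exact: between sy sx (convR_itv _ yx).
Qed.

Theorem theorem3p1 (R : realType) (L sigma : R) (p : R -> R)
    (hL : 0 <= L < 1) (hsigma : 0 < sigma ^+ 2 <= 1)
    (hp : is_pdf p) (hmom : has_first_second_moments p) :
  [/\ is_minimizer (lip_class L) (objective p sigma)
        (fstar L sigma (pdf_mean p)),
      forall f : R -> R,
        is_minimizer (lip_class L) (objective p sigma) f ->
        forall x, pdf_support p x -> f x = fstar L sigma (pdf_mean p) x &
      1 - sigma ^+ 2 > L ->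
      forall f : R -> R,
        is_minimizer (lip_class L) (objective p sigma) f ->
        forall x, convex_hull (pdf_support p : set R^o) x ->
          f x = fstar L sigma (pdf_mean p) x].
Proof.
have [/andP[L0 _] /andP[_ s1] [mp p0 _]] := And3 hL hsigma hp.
set m := pdf_mean p.
have fstarL : lip_class L (fstar L sigma m) by exact: fstar_lip_class.
have gap0 (f : R -> R) :
    (0 <= \int[lebesgue_measure]_x (p x * (fstar L sigma m x - f x) ^+ 2)%:E)%E.
  by apply: integral_ge0 => x _; rewrite lee_fin mulr_ge0// sqr_ge0.
have supp_uniq f : is_minimizer (lip_class L) (objective p sigma) f ->
    pdf_support p `<=` [set x | fstar L sigma m x - f x = 0].
  move=> [fL fmin] x /=.
  apply: (@support_eq0 _ p (fun x => fstar L sigma m x - f x)) => //.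
    move=> y; apply: cvgB; [exact: lip_class_continuous fstarL y|
                            exact: lip_class_continuous fL y].
  apply/eqP; rewrite eq_le gap0 andbT.
  have := objective_fstar_add_le _ _ hp hmom L sigma f fL.
  move=> /le_trans/(_ (fmin _ fstarL)).
  by rewrite -[leRHS]adde0 leeD2lE// (objective_fstar_fin_num _ _ hp hmom).
split.
- split=> // f fL.
  apply: le_trans (objective_fstar_add_le _ _ hp hmom L sigma f fL).
  by rewrite leeDl.
- by move=> f fmin x /(supp_uniq f fmin) /= /subr0_eq.
- move=> La f fmin x hull; have [fL _] := fmin.
  apply/esym/subr0_eq.
  apply: (hull [set x | fstar L sigma m x - f x = 0]).
  split; last exact: supp_uniq.
  exact/convex_set_homo_eq0/fstar_sub_homo.
Qed.
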